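(* Let $p$ be an odd prime, $m\ge 1$ an integer, $\beta\in\mathbb F_{p^m}$ with $\beta\neq 0$, and $i,j\in\{0,1\}$. Then the number $R_{p^m}^{(2)}(\beta,i,j)$ of representations of $\beta$ as the sum of an element of $\mathcal B_j$ and an element of $\mathcal B_i$ is $$R_{p^m}^{(2)}(\beta,i,j)=\frac14\left(p^m-2-\chi_2(\beta)(-1)^i-\chi_2(\beta)(-1)^j-(-1)^{i+j}\chi_2(-1)\right),$$ and, for fixed $p^m,i,j$, it depends only on the quadratic residuacity of $\beta$ (that is, only on the value $\chi_2(\beta)$).
   Context: $\mathbb F_{p^m}$ is the finite field with $p^m$ elements. $\mathcal B_0$ is the set of nonzero squares in $\mathbb F_{p^m}$ and $\mathcal B_1=\mathbb F_{p^m}^*\setminus\mathcal B_0$ is the set of non-squares. $\chi_2$ is the quadratic character: $\chi_2(x)=1$ for $x\in\mathcal B_0$, $\chi_2(x)=-1$ for $x\in\mathcal B_1$, and $\chi_2(0)=0$. Representations are ordered: $R_{p^m}^{(2)}(\beta,i,j)$ is the number of pairs $(z,w)\in\mathcal B_j\times\mathcal B_i$ with $z+w=\beta$ ($i=j$ is allowed). *)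

(* Defs.v *)
From mathcomp Require Import all_boot all_algebra.

Set Implicit Arguments.
Unset Strict Implicit.
Unset Printing Implicit Defensive.

Import GRing.Theory.
Local Open Scope ring_scope.

Definition nzsquares (F : finFieldType) : {set F} :=
  [set x | (x != 0) && [exists y : F, x == y ^+ 2]].

Definition nonsquares (F : finFieldType) : {set F} :=
  [set~ 0] :\: nzsquares F.

(* The classes B_0 (nonzero squares) and B_1 (non-squares). *)
Definition qclass (F : finFieldType) (k : 'I_2) : {set F} :=
  if k == 0 then nzsquares F else nonsquares F.

Definition chi2 (F : finFieldType) (x : F) : int :=
  if x \in nzsquares F then 1 else if x \in nonsquares F then -1 else 0.

(* Representations are ordered: the first summand lies in B_j, the second
   in B_i. *)
Definition nrepr (F : finFieldType) (beta : F) (i j : 'I_2) : nat :=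
  #|[set zw in setX (qclass F j) (qclass F i) | zw.1 + zw.2 == beta]|.

(* Main.v *)
(* The indicator of the class B_k is (chi^2 + (-1)^k chi) / 2, so four times the
   number of representations of beta expands into convolutions of chi and
   chi^2 at beta. Those involving chi^2, the indicator of the nonzero elements,
   follow from sum chi = 0. In sum_z chi(z) chi(beta - z) the term at z != 0 is
   chi(beta / z - 1), and beta / z - 1 takes every value except -1. *)
Require Import Defs.
From mathcomp Require Import all_boot all_algebra.
From mathcomp Require Import all_order finfield zify ring lra.
Import Order.TTheory GRing.Theory Num.Theory.
Local Open Scope ring_scope.

Lemma mem_nzsquares (F : finFieldType) (x : F) :
  reflect (exists2 y, y != 0 & x = y ^+ 2) (x \in nzsquares F).
Proof.
rewrite inE; apply: (iffP andP) => [[x0 /existsP[y /eqP xy]]|[y y0 ->]].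
  by exists y => //; apply: contraNneq x0 => y0; rewrite xy y0 expr0n.
by rewrite expf_neq0 //; split=> //; apply/existsP; exists y.
Qed.

Lemma mem_nonsquares (F : finFieldType) (x : F) :
  (x \in nonsquares F) = (x != 0) && (x \notin nzsquares F).
Proof. by rewrite !inE andbC. Qed.

Lemma chi2E (F : finFieldType) (x : F) :
  chi2 x = if x == 0 then 0 else if x \in nzsquares F then 1 else -1.
Proof.
rewrite /chi2 mem_nonsquares; case: eqP => [->|_] /=; last by case: (x \in _).
by rewrite inE eqxx.
Qed.

Lemma chi2_0 (F : finFieldType) : chi2 (0 : F) = 0.
Proof. by rewrite chi2E eqxx. Qed.

Lemma chi2_1 (F : finFieldType) : chi2 (1 : F) = 1.
Proof.
rewrite chi2E oner_eq0 ifT //.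
by apply/mem_nzsquares; exists 1; rewrite ?oner_eq0 ?expr1n.
Qed.

Lemma chi2_sqr (F : finFieldType) (x : F) : chi2 x ^+ 2 = (x != 0)%:R.
Proof. by rewrite chi2E; case: eqP => // _; case: ifP. Qed.

Lemma chi2_le1 (F : finFieldType) (x : F) : chi2 x <= 1.
Proof. by rewrite chi2E; do 2?case: ifP. Qed.

(** Needed in this weak form first: the proof of full multiplicativity rests on it. *)
Lemma chi2_sqrM (F : finFieldType) (y x : F) :
  y != 0 -> chi2 (y ^+ 2 * x) = chi2 x.
Proof.
move=> y0; rewrite !chi2E mulf_eq0 expf_eq0 (negPf y0) /=; case: eqP => // _.
suff -> : (y ^+ 2 * x \in nzsquares F) = (x \in nzsquares F) by [].
apply/mem_nzsquares/mem_nzsquares => -[a a0 E].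
  exists (a / y); first by rewrite mulf_neq0 ?invr_eq0.
  by rewrite expr_div_n -E mulrC mulKf ?expf_neq0.
by exists (y * a); rewrite ?mulf_neq0 // E exprMn.
Qed.

(** Doubling keeps the indicator identity within [int]. *)
Lemma qclass_chi2 (F : finFieldType) (k : 'I_2) (x : F) :
  (x \in qclass F k)%:R *+ 2 = chi2 x ^+ 2 + (-1) ^+ k * chi2 x.
Proof.
rewrite chi2_sqr chi2E /qclass.
case: k => [[|[|//]] lek] /=; rewrite ?mem_nonsquares.
  by rewrite inE; case: (x == 0) => //=; case: existsP.
by case: (x == 0) => //=; case: (x \in _).
Qed.

Lemma sum_chi2_sqr (F : finFieldType) :
  \sum_(x : F) chi2 x ^+ 2 = #|F|%:Z - 1.
Proof.
under eq_bigr do rewrite chi2_sqr.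
rewrite -sum1_card -natz natr_sum (bigD1 0) //= [in RHS](bigD1 0) //= eqxx add0r.
by rewrite addrAC subrr add0r; apply: eq_bigr => x ->.
Qed.

(** A representation of [beta] is determined by its first summand. *)
Lemma nrepr_sum (F : finFieldType) (beta : F) (i j : 'I_2) :
  nrepr beta i j =
    (\sum_(z : F) (z \in qclass F j) * ((beta - z)%R \in qclass F i))%N.
Proof.
have inj : injective (fun z : F => (z, beta - z)) by move=> u v [].
transitivity #|[set z | (z \in qclass F j) && (beta - z \in qclass F i)]|.
  rewrite -(card_imset _ inj); apply: eq_card => -[z w].
  rewrite !inE /=; apply/andP/imsetP => [[zw /eqP <-]|[u uP [-> ->]]].
    by exists z; rewrite ?inE addrAC subrr add0r.
  by move: uP; rewrite inE [u + _]addrC subrK eqxx.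
rewrite -sum1dep_card big_mkcond; apply: eq_bigr => z _.
by do 2!case: (_ \in _).
Qed.

Section OddCharacteristic.
Variable F : finFieldType.
Hypothesis nz2 : 2%:R != 0 :> F.

(** A nonzero square has exactly the roots [a] and [- a], distinct because 2 is nonzero; 0 has a
    single root. *)
Lemma sum_sqrt_chi2 (x : F) : \sum_(y : F) (y ^+ 2 == x)%:R = 1 + chi2 x.
Proof.
rewrite chi2E; case: eqVneq => [->|x0].
  rewrite (bigD1 0) //= expr0n eqxx big1 ?addr0 // => y /negPf y0.
  by rewrite expf_eq0 y0.
case: mem_nzsquares => [[a a0 ->]|nsq].
  have aNa : - a != a.
    by rewrite eq_sym -addr_eq0 -mulr2n -mulr_natr mulf_neq0.
  rewrite (bigD1 a) // (bigD1 (- a)) //= eqxx sqrrN eqxx big1 // => y.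
  by rewrite eqf_sqr => /andP[/negPf -> /negPf ->].
rewrite big1 // => y _; case: eqP => // E; case: nsq.
by exists y => //; apply: contraNneq x0 => y0; rewrite -E y0 expr0n.
Qed.

(** Double counting: each [y] is a square root of exactly one [x], so the numbers of roots
    [1 + chi2 x] add up to the size of [F]. *)
Lemma sum_chi2 : \sum_(x : F) chi2 x = 0.
Proof.
apply: (@addrI _ (\sum_(x : F) 1)); rewrite addr0 -big_split /=.
under eq_bigr do rewrite -sum_sqrt_chi2.
rewrite exchange_big /=; apply: eq_bigr => y _.
by rewrite (bigD1 (y ^+ 2)) //= eqxx big1 ?addr0 // => x; rewrite eq_sym => /negPf ->.
Qed.

(* For a nonsquare [x], every term [chi2 z + chi2 (x * z)] is at most 0, while
   these terms add up to 0. *)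
Lemma chi2M (x y : F) : chi2 (x * y) = chi2 x * chi2 y.
Proof.
have [->|x0] := eqVneq x 0; first by rewrite mul0r chi2_0 mul0r.
have [/mem_nzsquares[a a0 ->]|nsqx] := boolP (x \in nzsquares F).
  by rewrite chi2_sqrM // -[a ^+ 2]mulr1 chi2_sqrM // chi2_1 mul1r.
have chix : chi2 x = -1 by rewrite chi2E (negPf x0) (negPf nsqx).
have le0 z : true -> 0 <= - (chi2 z + chi2 (x * z)).
  move=> _; rewrite oppr_ge0; have := chi2_le1 _ (x * z).
  (* For [z] a nonzero square the second term is [chi2 x], that is -1; for [z] a nonsquare the first
     is -1. The other term is at most 1. *)
  have [/mem_nzsquares[a a0 ->]|nsqz] := boolP (z \in nzsquares F).
    by rewrite [x * _]mulrC chi2_sqrM // chix => _; have := chi2_le1 _ (a ^+ 2); lra.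
  have [->|z0] := eqVneq z 0; first by rewrite mulr0 !chi2_0.
  by rewrite (chi2E F z) (negPf z0) (negPf nsqz); lra.
have s0 : \sum_(z : F) - (chi2 z + chi2 (x * z)) = 0.
  rewrite sumrN big_split /= sum_chi2 add0r -[RHS]oppr0; congr (- _).
  by rewrite -[RHS]sum_chi2 [RHS](reindex_inj (mulfI x0)).
have /= /eqP := @psumr_eq0P _ _ _ _ le0 s0 y isT.
by rewrite chix mulN1r oppr_eq0 addrC addr_eq0 => /eqP.
Qed.

Lemma jacobi_sum_chi2 (beta : F) : beta != 0 ->
  \sum_(z : F) chi2 z * chi2 (beta - z) = - chi2 (-1 : F).
Proof.
move=> b0.
apply: (@addIr _ (chi2 (-1 : F))); rewrite addNr -[RHS]sum_chi2.
(* Since the inverse of 0 is 0 by convention, this map sends 0 to -1, the value otherwise missed,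
   and so permutes all of [F]. *)
have inj : injective (fun z : F => beta / z - 1).
  by move=> u v /addIr /(mulfI b0) /invr_inj.
rewrite [RHS](reindex_inj inj) /= (bigD1 0) //= [RHS](bigD1 0) //=.
rewrite chi2_0 mul0r add0r invr0 mulr0 sub0r addrC; congr (_ + _).
apply: eq_bigr => z z0.
(* Here [z * (beta - z) = z ^+ 2 * (beta / z - 1)]. *)
by rewrite -chi2M -[RHS](@chi2_sqrM F z) //; congr chi2; field.
Qed.

End OddCharacteristic.

Lemma four_nrepr (F : finFieldType) (beta : F) (i j : 'I_2) :
  2%:R != 0 :> F -> beta != 0 ->
  (nrepr beta i j)%:Z *+ 4 =
    (#|F|)%:Z - 2 - chi2 beta * (-1) ^+ i - chi2 beta * (-1) ^+ j
    - (-1) ^+ (i + j) * chi2 (-1 : F).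
Proof.
move=> nz2 b0.
pose S (f g : F -> int) := \sum_(z : F) f z * g (beta - z).
pose c (x : F) := chi2 x.
pose e (x : F) := chi2 x ^+ 2.
have subI : injective (fun z : F => beta - z) by move=> u v /addrI /oppr_inj.
(* As [e] is the indicator of the nonzero elements, only the term at [z = beta] is lost. *)
have Se (f : F -> int) : S f e = \sum_z f z - f beta.
  rewrite /S [X in _ = X - _](bigD1 beta) //= (bigD1 beta) //= /e chi2_sqr.
  rewrite subrr eqxx mulr0 add0r addrAC subrr add0r.
  by apply: eq_bigr => z zb; rewrite chi2_sqr subr_eq0 eq_sym zb mulr1.
have SC f g : S f g = S g f.
  rewrite /S (reindex_inj subI); apply: eq_bigr => z _ /=.
  by rewrite subKr mulrC.
have nE : (nrepr beta i j)%:Z =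
    S (fun z => (z \in qclass F j)%:R) (fun w => (w \in qclass F i)%:R).
  by rewrite nrepr_sum /S -natz natr_sum; apply: eq_bigr => z _; rewrite natrM.
have -> : (nrepr beta i j)%:Z *+ 4 =
    S e e + (-1) ^+ j * S c e + (-1) ^+ i * S e c + (-1) ^+ (i + j) * S c c.
  rewrite nE (mulrnA _ 2 2) /S -!sumrMnl !mulr_sumr -!big_split /=.
  apply: eq_bigr => z _; rewrite -mulrnAr -mulrnAl !qclass_chi2 exprD /e /c.
  by move: ((-1) ^+ i) ((-1) ^+ j) => s t; ring.
(* This gives [S e e = #|F| - 2], while [S c e] and [S e c] both equal [- chi2 beta]. *)
rewrite (SC e) !Se /c sum_chi2 // /e sum_chi2_sqr chi2_sqr b0 /=.
rewrite /S jacobi_sum_chi2 //.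
by move: ((-1) ^+ i) ((-1) ^+ j) ((-1) ^+ (i + j)) => s t u; ring.
Qed.

Theorem theorem1 (p m : nat) (F : finFieldType) (i j : 'I_2) :
  prime p -> odd p -> (1 <= m)%N -> #|F| = (p ^ m)%N ->
  (forall beta : F, beta != 0 ->
     (nrepr beta i j)%:R =
       1 / 4 * ((p ^ m)%N%:Z - 2 - chi2 beta * (-1) ^+ i
                - chi2 beta * (-1) ^+ j
                - (-1) ^+ (i + j) * chi2 (-1 : F))%:~R :> rat)
  /\ (forall beta beta' : F, beta != 0 -> beta' != 0 ->
        chi2 beta = chi2 beta' -> nrepr beta i j = nrepr beta' i j).
Proof.
move=> primep oddp _ cardF.
have nz2 : 2%:R != 0 :> F.
  (* [F] has characteristic [p], so 2 vanishes in it only if [p] divides 2. *)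
  rewrite -(dvdn_pcharf (card_finPcharP cardF primep)).
  by apply: contraL oddp; rewrite dvdn_prime2 // => /eqP ->.
have N4 beta := @four_nrepr F beta i j nz2.
split=> [beta b0|beta beta' b0 b'0 chiE].
  rewrite -cardF -N4 // rmorphMn /= -pmulrn -[RHS]/(_ * (_ *+ 4)).
  by field.
have := N4 _ b0; rewrite chiE -N4 //; lia.
Qed.
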